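(* For every integer $d\ge 2$ the following hold. (a) For all $n\ge 0$, $$ \mathcal{E}_n^{(d)}=\sum_{\pi\models_d [n]}(-1)^{\ell(\pi)}. $$ (b) For all $n\ge 0$, $\mathcal{E}_n^{(d)}\in\mathbb{Z}$. (c) For all $n\ge 0$, $\mathcal{E}_n^{(d)}=0$ if $n$ is not a multiple of $d$. (d) $\mathcal{E}_0^{(d)}=1$, and for $n\ge 1$, $$ \mathcal{E}_{dn}^{(d)}=-\sum_{i=0}^{n-1}\binom{dn}{di}\mathcal{E}_{di}^{(d)}. $$ (e) For all $n\ge 0$, $$ \mathcal{E}_{dn}^{(d)}=(-1)^n\,\# A_{dn}^{(d)}. $$
   Context: For an integer $d\ge 2$, the generalized Euler numbers $\mathcal{E}_n^{(d)}$, $n\ge 0$, are defined by the formal power series identity $$ \sum_{n\ge 0}\mathcal{E}_n^{(d)}\frac{x^n}{n!}=\frac{1}{1+x^d/d!+x^{2d}/(2d)!+\cdots}=\frac{1}{\sum_{k\ge 0}x^{dk}/(dk)!}, $$ i.e. $\mathcal{E}_n^{(d)}$ is $n!$ times the coefficient of $x^n$ in the multiplicative inverse of the formal power series $\sum_{k\ge0}x^{dk}/(dk)!$ over $\mathbb{Q}$. $[n]=\{1,2,\dots,n\}$ (so $[0]=\emptyset$). An ordered set partition of a finite set $S$ is a sequence $\pi=(B_1,\dots,B_k)$ of nonempty subsets of $S$ (called blocks) whose disjoint union is $S$; the order of the blocks matters. Its length is $\ell(\pi)=k$. The empty set has exactly one ordered set partition, the empty sequence, of length $0$. One writes $\pi\models_d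 S$ if $\pi$ is an ordered set partition of $S$ such that every block has cardinality divisible by $d$. Let $\mathfrak{S}_n$ be the symmetric group of all permutations $\sigma=\sigma_1\sigma_2\cdots\sigma_n$ of $[n]$ in one-line notation ($\mathfrak{S}_0$ consists of the empty permutation). The descent set of $\sigma$ is $\mathrm{Des}\,\sigma=\{i\mid 1\le i<n,\ \sigma_i>\sigma_{i+1}\}$. The permutation $\sigma\in\mathfrak{S}_n$ is $d$-alternating if $\mathrm{Des}\,\sigma=\{di\mid d\le di<n\}$ (the set of all positive multiples of $d$ less than $n$), and $A_n^{(d)}$ denotes the set of $d$-alternating $\sigma\in\mathfrak{S}_n$. $\#$ denotes cardinality. *)

(* Defs.v *)
From mathcomp Require Import all_boot all_order all_fingroup all_algebra.

Set Implicit Arguments.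
Unset Strict Implicit.
Unset Printing Implicit Defensive.

Import GRing.Theory.
Local Open Scope ring_scope.

(* A formal power series is given by its coefficients. *)
Definition fps (F : fieldType) : Type := nat -> F.

Definition fps_one (F : fieldType) : fps F := fun n => (n == 0%N)%:R.

Definition fps_mul (F : fieldType) (a b : fps F) : fps F :=
  fun n => \sum_(i < n.+1) a i * b (n - i)%N.

(* First n coefficients of the inverse b of a, solved in turn from            *)
(*   a_0 b_0 = 1  and  a_0 b_n + \sum_(i < n) a_(n - i) b_i = 0 for n > 0;    *)
(* see fps_mulV and fps_inv_unique.                                           *)
Fixpoint fps_inv_seq (F : fieldType) (a : fps F) (n : nat) : seq F :=
  if n is m.+1 then
    let s := fps_inv_seq a m in
    rcons s ((a 0%N)^-1 * ((m == 0%N)%:R - \sum_(i < m) a (m - i)%N * s`_i))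
  else [::].

Definition fps_inv (F : fieldType) (a : fps F) : fps F :=
  fun n => (fps_inv_seq a n.+1)`_n.

Lemma size_fps_inv_seq (F : fieldType) (a : fps F) (n : nat) :
  size (fps_inv_seq a n) = n.
Proof. by elim: n => //= n IHn; rewrite size_rcons IHn. Qed.

Lemma nth_fps_inv_seq (F : fieldType) (a : fps F) (n i : nat) :
  (i < n)%N -> (fps_inv_seq a n)`_i = fps_inv a i.
Proof.
elim: n => // n IHn; rewrite ltnS leq_eqVlt => /predU1P[-> // | lt_in].
by rewrite /= nth_rcons size_fps_inv_seq lt_in IHn.
Qed.

Lemma fps_invE (F : fieldType) (a : fps F) (n : nat) :
  fps_inv a n =
    (a 0%N)^-1 * ((n == 0%N)%:R - \sum_(i < n) a (n - i)%N * fps_inv a i).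
Proof.
rewrite {1}/fps_inv /= nth_rcons size_fps_inv_seq ltnn eqxx.
by under eq_bigr => i _ do rewrite nth_fps_inv_seq //.
Qed.

Lemma fps_mulV (F : fieldType) (a : fps F) :
  a 0%N != 0 -> fps_mul (fps_inv a) a =1 @fps_one F.
Proof.
move=> a0 n; rewrite /fps_mul big_ord_recr /= subnn.
rewrite [in X in _ + X]fps_invE [_ * a 0%N]mulrC mulrA divff // mul1r.
under eq_bigr => i _ do rewrite mulrC.
by rewrite addrC subrK.
Qed.

Lemma fps_inv_unique (F : fieldType) (a b : fps F) :
  a 0%N != 0 -> fps_mul b a =1 @fps_one F -> b =1 fps_inv a.
Proof.
move=> a0 ba n; elim/ltn_ind: n => n IHn.
have:= ba n; rewrite -(fps_mulV a0) /fps_mul !big_ord_recr /= subnn.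
under eq_bigr => i _ do rewrite IHn //.
by move/addrI/(mulIf a0).
Qed.

(* The series \sum_(k >= 0) x^(d k) / (d k)!, for d > 0. *)
Definition exp_mult (d : nat) : fps rat :=
  fun n => if (d %| n)%N then (n`!)%:R^-1 else 0.

Definition gen_euler (d n : nat) : rat :=
  (n`!)%:R * fps_inv (exp_mult d) n.

Definition egf (e : nat -> rat) : fps rat := fun n => e n / (n`!)%:R.

Lemma gen_eulerP (d : nat) :
  fps_mul (egf (gen_euler d)) (exp_mult d) =1 @fps_one rat.
Proof.
have e0 : exp_mult d 0%N != 0 by rewrite /exp_mult dvdn0.
move=> n; rewrite -(fps_mulV e0); apply: eq_bigr => i _; congr (_ * _).
by rewrite /egf /gen_euler mulrC mulKf // Num.Theory.pnatr_eq0 -lt0n fact_gt0.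
Qed.

Definition ordered_partition (T : finType) (S : {set T}) (p : seq {set T})
    : bool :=
  [&& set0 \notin p, pairwise (fun A B : {set T} => [disjoint A & B]) p
    & \bigcup_(B <- p) B == S].

Definition d_partition (d : nat) (T : finType) (S : {set T})
    (p : seq {set T}) : bool :=
  ordered_partition S p && all (fun B : {set T} => d %| #|B|)%N p.

(* Hence the ordered set partitions of S all belong to the finite type        *)
(* #|S|.-bseq {set T} of sequences of length at most #|S|.                    *)
Lemma size_ordered_partition (T : finType) (S : {set T}) (p : seq {set T}) :
  ordered_partition S p -> (size p <= #|S|)%N.
Proof.
elim: p S => [//|B p IHp] S /and3P[].
rewrite inE negb_or eq_sym => /andP[B0 p0] /= /andP[Bp pp].
rewrite big_cons => /eqP <-.
have dB : [disjoint B & \bigcup_(A <- p) A].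
  elim: {p0 pp IHp} p Bp => [|A p IH] /=.
    by rewrite big_nil disjoints_subset setC0 subsetT.
  move=> /andP[BA Bp]; rewrite big_cons -setI_eq0 setIUr setU_eq0 !setI_eq0.
  by rewrite BA IH.
have [_] := leq_card_setU B (\bigcup_(A <- p) A); rewrite dB => /eqP ->.
by rewrite -add1n leq_add ?card_gt0 // IHp // /ordered_partition p0 pp eqxx.
Qed.

(* The set [n] is represented by 'I_n, where i : 'I_n stands for i + 1.  The  *)
(* value of i as a descent is not shifted: i > 0 is a descent when            *)
(* sigma_i > sigma_(i+1), which are the values of s at the ordinals i - 1     *)
(* and i.                                                                     *)
Definition descents (n : nat) (s : 'S_n) : {set 'I_n} :=
  [set i : 'I_n | [exists j : 'I_n, (j.+1 == i :> nat) && (s i < s j)%N]].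

Definition d_alternating (d n : nat) : {set 'S_n} :=
  [set s : 'S_n | descents s == [set i : 'I_n | (0 < i)%N && (d %| i)%N]].

(* Main.v *)
Require Import Defs.
From mathcomp Require Import all_boot all_order all_fingroup all_algebra.

(** Comparing coefficients in E(x) * (\sum_k x^(dk) / (dk)!) = 1 gives the
    recurrence E_n = [n = 0] - \sum_(i < n, d | n - i) C(n, i) E_i
    (gen_euler_rec).  It yields (c) by induction, since i is not a multiple of
    d when n is not and d | n - i, and it is (d) when n is a multiple of d.

    For (a), the recurrence is read on a finite set S instead of the number
    n = #|S|: the factor C(n, i) counts the subsets B of S with n - i elements,
    so E_#|S| is minus the sum of E_#|S - B| over the nonempty B of size
    divisible by d (gen_euler_subset_rec).  Removing the first block B of an
    ordered set partition of S shows that the signed sum of (a) obeys the same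
    recursion (sum_d_partition_cons).  Integrality (b) is then visible.

    For (e), consider the words w listing a set of d n integers, n > 0, and
    the n + 1 cutting positions d j.  Say that the cut is good if w increases
    before it and is d-alternating after it.  The descents of w are then
    prescribed everywhere except at d j, so a cut with 0 < j < n is good
    exactly when the descent set of w is {d j, ..., d (n - 1)} or
    {d (j + 1), ..., d (n - 1)}.  Hence the signed number of good cuts of each
    word telescopes to 0 (signed_cuts_eq0).  On the other hand, a word with a
    good cut at d j is a subset B of size d j, listed increasingly, followed by
    a d-alternating word on the complement of B (count_words_cut); so the
    numbers (-1)^n #A_(dn) satisfy (d).  Working with words on arbitrary
    subsets of 'I_N makes the remainder of a cut word again an object of the
    same kind, without renumbering its letters. *)

Set Implicit Arguments.
Unset Strict Implicit.
Unset Printing Implicit Defensive.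

Import GRing.Theory.
Local Open Scope ring_scope.

(** * The binomial recurrence *)

Lemma gen_euler_rec (d n : nat) :
  gen_euler d n = (n == 0%N)%:R
    - \sum_(i < n | (d %| n - i)%N) 'C(n, i)%:R * gen_euler d i.
Proof.
have fact_neq0 k : k`!%:R != 0 :> rat.
  by rewrite Num.Theory.pnatr_eq0 -lt0n fact_gt0.
rewrite {1}/gen_euler fps_invE {1}/exp_mult dvdn0 invr1 mul1r mulrBr.
congr (_ - _); first by case: n => [|n] /=; rewrite ?fact0 ?mulr1 ?mulr0.
rewrite mulr_sumr [RHS]big_mkcond /=; apply: eq_bigr => i _.
rewrite /exp_mult; case: ifP => _; last by rewrite mul0r mulr0.
rewrite /gen_euler mulrA mulrA; congr (_ * _).
rewrite -(bin_fact (ltnW (ltn_ord i))) !natrM mulrA.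
by rewrite -!mulrA divff ?mulr1.
Qed.

Lemma gen_euler0 (d : nat) : gen_euler d 0 = 1.
Proof. by rewrite gen_euler_rec big_ord0 subr0. Qed.

Lemma gen_euler_eq0 (d n : nat) : ~~ (d %| n)%N -> gen_euler d n = 0.
Proof.
elim/ltn_ind: n => n IHn ndn; rewrite gen_euler_rec big1 => [|i d_ni].
  by rewrite subr0; case: eqP ndn => // ->; rewrite dvdn0.
rewrite (IHn i) ?mulr0 //; apply: contra ndn => di.
by rewrite -(subnK (ltnW (ltn_ord i))) dvdn_add.
Qed.

(** The indices are cut into runs d i, ..., d i + d - 1, each of which contains
    a single multiple of d. *)
Lemma sum_multiples (d n : nat) (F : nat -> rat) : (0 < d)%N ->
  \sum_(i < d * n | (d %| i)%N) F i = \sum_(0 <= i < n) F (d * i)%N.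
Proof.
move=> d0; rewrite -(big_mkord (dvdn d) F) big_mkcond mulnC big_nat_mul.
apply: eq_big_nat => i _; rewrite big_ltn ?ltn_mul2r ?d0 ?ltnSn //.
rewrite dvdn_mull //= [X in _ + X]big_nat_cond big1 => [|j]; first by rewrite addr0 mulnC.
rewrite andbT => /andP[lo hi]; case: ifP => // /dvdnP[q def_j].
by move: lo hi; rewrite def_j !ltn_mul2r d0 /= ltnS => lo /(leq_trans lo); rewrite ltnn.
Qed.

Lemma gen_euler_rec_multiples (d n : nat) : (0 < d)%N -> (0 < n)%N ->
  gen_euler d (d * n) =
    - \sum_(0 <= i < n) 'C(d * n, d * i)%:R * gen_euler d (d * i).
Proof.
move=> d0 n0; have dn0 : (d * n)%N == 0%N = false.
  by rewrite muln_eq0 !gtn_eqF.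
rewrite gen_euler_rec dn0 sub0r; congr (- _).
pose F i := 'C(d * n, i)%:R * gen_euler d i.
rewrite -[RHS]/(\sum_(0 <= i < n) F (d * i)%N) -sum_multiples //.
apply: eq_bigl => i; rewrite dvdn_subr ?dvdn_mulr //; exact: ltnW.
Qed.

Lemma sum_subset_card (T : finType) (S : {set T}) (F : nat -> rat) :
  \sum_(B : {set T} | B \subset S) F #|B| =
  \sum_(k < #|S|.+1) 'C(#|S|, k)%:R * F k.
Proof.
rewrite (partition_big (fun B : {set T} => inord #|B| : 'I_#|S|.+1) xpredT) //=.
apply: eq_bigr => k _.
have cardk (B : {set T}) :
    (B \subset S) && (inord #|B| == k) = (B \in [set A : {set T} | A \subset S & #|A| == k]).
  rewrite inE; case: (boolP (B \subset S)) => //= /subset_leq_card sBS.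
  by rewrite -val_eqE /= inordK.
rewrite (eq_bigl _ _ cardk) (eq_bigr (fun=> F k)) => [|B].
  by rewrite sumr_const cards_draws mulr_natl.
by rewrite inE => /andP[_ /eqP->].
Qed.

(** The form of the recurrence that combinatorial objects on S satisfy when
    they are built by choosing a first block B and an object on S - B. *)
Lemma gen_euler_subset_rec (d : nat) (T : finType) (S : {set T}) :
  gen_euler d #|S| = (S == set0)%:R
    - \sum_(B : {set T} | [&& B != set0, B \subset S & (d %| #|B|)%N])
        gen_euler d #|S :\: B|.
Proof.
rewrite gen_euler_rec cards_eq0; congr (_ - _).
(* The empty block is weighted by 0, so that F can be summed over all of S. *)
pose F k := if (k != 0%N) && (d %| k)%N then gen_euler d (#|S| - k) else 0.
transitivity (\sum_(B : {set T} | B \subset S) F #|B|); last first.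
  rewrite big_mkcond [RHS]big_mkcond /=; apply: eq_bigr => B _.
  rewrite /F cards_eq0 [_ && (_ && _)]andbCA.
  by case: ifP => // sBS; rewrite cardsDS.
rewrite sum_subset_card big_ord_recl /F eqxx mulr0 add0r.
rewrite (reindex_inj rev_ord_inj) big_mkcond /=; apply: eq_bigr => i _.
rewrite /bump add1n subKn //= bin_sub //.
by case: ifP => _; rewrite ?mulr0.
Qed.

(** * Ordered set partitions *)

Lemma disjoint_bigcup_seq (T : finType) (B : {set T}) (p : seq {set T}) :
  [disjoint B & \bigcup_(A <- p) A] = all (fun A : {set T} => [disjoint B & A]) p.
Proof.
elim: p => [|A p IHp]; first by rewrite big_nil -setI_eq0 setI0 eqxx.
by rewrite big_cons -setI_eq0 setIUr setU_eq0 !setI_eq0 IHp.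
Qed.

Lemma d_partition_nil (d : nat) (T : finType) (S : {set T}) :
  d_partition d S [::] = (S == set0).
Proof. by rewrite /d_partition /ordered_partition big_nil /= andbT eq_sym. Qed.

Lemma d_partition_cons (d : nat) (T : finType) (S B : {set T}) p :
  d_partition d S (B :: p) =
  [&& B != set0, B \subset S & (d %| #|B|)%N] && d_partition d (S :\: B) p.
Proof.
rewrite /d_partition /ordered_partition /= inE negb_or eq_sym big_cons.
rewrite -disjoint_bigcup_seq; set U := \bigcup_(A <- p) A.
have eqU : [disjoint B & U] && (B :|: U == S) = (B \subset S) && (U == S :\: B).
  apply/andP/andP=> [[dBU /eqP<-] | [sBS /eqP->]].
    rewrite subsetUl setDUl setDv set0U; split=> //.
    by apply/eqP/esym/setDidPl; rewrite disjoint_sym.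
  rewrite -setI_eq0 setIDA [B :&: S]setIC -setIDA setDv setI0.
  by rewrite -{1}(setIidPr sBS) setID !eqxx.
rewrite [_ && _ && (_ == S)]andbAC eqU.
case: (B != set0); case: (B \subset S); case: (d %| _)%N; rewrite ?andbF //=.
by rewrite [(U == _) && _]andbC.
Qed.

Lemma d_partition_set0 (d : nat) (T : finType) (p : seq {set T}) :
  d_partition d set0 p = (p == [::]).
Proof.
case: p => [|B p]; first by rewrite d_partition_nil eqxx.
by rewrite d_partition_cons subset0; case: (B =P set0).
Qed.

(** Removing the first block is a bijection, and changes the sign.  The set S
    is nonempty so that there is a first block. *)
Lemma sum_d_partition_cons (d N : nat) (T : finType) (S : {set T}) :
  S != set0 ->
  \sum_(p : N.+1.-bseq {set T} | d_partition d S p) (-1) ^+ size p =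
  - \sum_(B : {set T} | [&& B != set0, B \subset S & (d %| #|B|)%N])
       \sum_(p : N.-bseq {set T} | d_partition d (S :\: B) p)
         (-1) ^+ size p :> rat.
Proof.
move=> S0; rewrite pair_big_dep /=.
pose h (u : {set T} * N.-bseq {set T}) := cons_bseq u.1 u.2.
pose h' (p : N.+1.-bseq {set T}) : {set T} * N.-bseq {set T} :=
  (head set0 p, [bseq of behead p]).
rewrite (reindex_onto h h') => [|p]; last first.
  move=> dp; apply: val_inj; rewrite /=.
  by case: (val p) dp => //; rewrite d_partition_nil (negPf S0).
rewrite -sumrN; apply: eq_big => [[B p]|[B p] _] /=.
  rewrite d_partition_cons.
  suff -> : h' (h (B, p)) = (B, p) by rewrite eqxx andbT.
  by congr pair; apply: val_inj.
by rewrite exprS mulN1r.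
Qed.

(** The bound N on the length is independent of S, so that the induction can
    remove one from N while S loses the whole block B. *)
Lemma signed_d_partitions (d N : nat) (T : finType) (S : {set T}) :
  (#|S| <= N)%N ->
  \sum_(p : N.-bseq {set T} | d_partition d S p) (-1) ^+ size p =
  gen_euler d #|S|.
Proof.
have base M : \sum_(p : M.-bseq {set T} | d_partition d set0 p) (-1) ^+ size p
    = gen_euler d #|@set0 T|.
  rewrite cards0 gen_euler0 (big_pred1 [bseq]) // => p.
  exact: d_partition_set0.
elim: N S => [|N IHN] S.
  by rewrite leqn0 cards_eq0 => /eqP->.
have [-> // | S0 leSN] := eqVneq S set0.
rewrite sum_d_partition_cons // gen_euler_subset_rec (negPf S0) sub0r.
congr (- _); apply: eq_bigr => B /and3P[B0 sBS _]; apply: IHN.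
rewrite cardsDS // leq_subLR (leq_trans leSN) // -add1n leq_add2r.
by rewrite card_gt0.
Qed.

Lemma gen_euler_int (d n : nat) : gen_euler d n \is a Num.int.
Proof.
rewrite -[n]card_ord -cardsT -(signed_d_partitions _ (leqnn _)).
by apply: rpred_sum => p _; rewrite rpredX // rpredN1.
Qed.

(** * Words and their descents *)

Definition descent_at (w : seq nat) (i : nat) : bool :=
  (nth 0 w i < nth 0 w i.-1)%N.

Definition descents_are (D : pred nat) (w : seq nat) : bool :=
  all (fun i => descent_at w i == D i) (iota 1 (size w).-1).

Lemma descents_areP (D : pred nat) (w : seq nat) :
  reflect (forall i, (0 < i < size w)%N -> descent_at w i = D i)
          (descents_are D w).
Proof.
apply: (iffP allP) => [dw i lt_i | dw i].
  rewrite (eqP (dw i _)) // mem_iota add1n.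
  by case: size lt_i => [|m]; rewrite ?andbF.
rewrite mem_iota add1n => lt_i; rewrite dw //.
by case: size lt_i => //; case: (i).
Qed.

Definition alternating (d : nat) : pred (seq nat) := descents_are (dvdn d).

Definition alternating_from (d k : nat) : pred (seq nat) :=
  descents_are (fun i => (d %| i)%N && (k <= i)%N).

Definition cut_alternating (d k : nat) : pred (seq nat) :=
  fun w => sorted leq (take k w) && alternating d (drop k w).

(** A good cut at k prescribes the descents of w everywhere except at k, where
    the last letter before the cut meets the first one after it. *)
Lemma cut_alternatingP (d k : nat) (w : seq nat) :
  (d %| k)%N -> (k <= size w)%N ->
  reflect (forall i, (0 < i < size w)%N -> i != k ->
             descent_at w i = (d %| i)%N && (k <= i)%N)
          (cut_alternating d k w).
Proof.
move=> dk lekw; apply: (iffP andP) => [[/(sortedP 0%N) sw /descents_areP aw] i | dw].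
  case/andP=> i0 ltiw; rewrite neq_ltn => /orP[ltik | ltki].
    rewrite leqNgt ltik andbF; apply/negbTE; rewrite -leqNgt.
    case: i i0 ltiw ltik => // i _ _ ltik.
    have:= sw i; rewrite size_take_min (minn_idPl lekw) ltik !nth_take //.
      by apply.
    exact: ltnW.
  have [m def_i] : exists m, i = (k + m.+1)%N.
    by exists (i - k).-1; rewrite prednK ?subn_gt0 // subnKC // ltnW.
  move: ltiw; rewrite def_i leq_addr andbT dvdn_addr // -ltn_subRL => ltm.
  rewrite -[RHS]aw ?size_drop ?ltm // /descent_at !nth_drop.
  by rewrite addnS.
split.
  apply/(sortedP 0%N) => i; rewrite size_take_min (minn_idPl lekw) => ltik.
  rewrite !nth_take //; last exact: ltnW.
  have:= dw i.+1; rewrite neq_ltn ltik (leq_trans ltik) // => /(_ isT isT).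
  by rewrite leqNgt ltik andbF => /negbT; rewrite -leqNgt.
apply/descents_areP => i; rewrite size_drop => /andP[i0 lti].
have:= dw (k + i)%N; rewrite -ltn_subRL lti addn_gt0 i0 orbT leq_addr !andbT.
rewrite dvdn_addr // -{2}[k]addn0 eqn_add2l -lt0n => /(_ isT i0) <-.
by rewrite /descent_at !nth_drop; case: i i0 {lti} => // i _; rewrite addnS.
Qed.

(** Whether or not there is a descent at the cut d j decides which of the two
    exact descent sets occurs.  At j = 0 no letter precedes the cut, and only
    the second one is possible. *)
Lemma cut_alternating_split (d n j : nat) (w : seq nat) :
  (0 < d)%N -> size w = (d * n)%N -> (j < n)%N ->
  (cut_alternating d (d * j) w
    = ((0 < j) && alternating_from d (d * j) w) + alternating_from d (d * j.+1) w
     :> nat)%N.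
Proof.
move=> d0 size_w ltjn.
have ltdj : (d * j < size w)%N by rewrite size_w ltn_pmul2l.
(* No multiple of d lies strictly between d j and d (j + 1). *)
have step i : i != (d * j)%N ->
    (d %| i)%N && (d * j.+1 <= i)%N = (d %| i)%N && (d * j <= i)%N.
  case: dvdnP => // [[q ->]]; rewrite [(q * d)%N]mulnC !leq_pmul2l //.
  by rewrite eqn_pmul2l // [(j < q)%N]ltn_neqAle eq_sym => ->.
have cutP := cut_alternatingP (dvdn_mulr j (dvdnn d)) (ltnW ltdj).
have from_cut : alternating_from d (d * j) w =
    cut_alternating d (d * j) w && ((0 < j)%N ==> descent_at w (d * j)).
  apply/descents_areP/andP=> [dw | [/cutP dw dj] i lti].
    split; first by apply/cutP => i lti _; apply: dw.
    by apply/implyP => j0; rewrite dw ?muln_gt0 ?d0 ?j0 // dvdn_mulr // leqnn.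
  have [def_i | neq_i] := eqVneq i (d * j)%N; last exact: dw.
  move: lti dj; rewrite def_i muln_gt0 d0 /= => /andP[-> _] /= ->.
  by rewrite dvdn_mulr // leqnn.
have from_succ : alternating_from d (d * j.+1) w =
    cut_alternating d (d * j) w && ((0 < j)%N ==> ~~ descent_at w (d * j)).
  apply/descents_areP/andP=> [dw | [/cutP dw dj] i lti].
    split; first by apply/cutP => i lti neq_i; rewrite dw // step.
    apply/implyP => j0; rewrite dw ?muln_gt0 ?d0 ?j0 //.
    by rewrite leq_pmul2l // ltnn andbF.
  have [def_i | neq_i] := eqVneq i (d * j)%N; last by rewrite dw // step.
  move: lti dj; rewrite def_i muln_gt0 d0 /= => /andP[-> _] /= /negbTE->.
  by rewrite leq_pmul2l // ltnn andbF.
rewrite from_cut from_succ; case: (cut_alternating _ _ _); last by rewrite andbF.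
by case: (0 < j)%N; case: (descent_at _ _).
Qed.

(** With q_j = 1 if the descent set of w is {d j, ..., d (n - 1)} and 0
    otherwise, the cut at 0 contributes q_1, the cut at d j contributes
    (-1)^j (q_j + q_(j + 1)) for 0 < j < n, and the cut at the end contributes
    (-1)^n q_n. *)
Lemma signed_cuts_eq0 (d n : nat) (w : seq nat) :
  (0 < d)%N -> (0 < n)%N -> size w = (d * n)%N ->
  \sum_(j < n.+1) (-1) ^+ j * (cut_alternating d (d * j) w)%:R = 0 :> rat.
Proof.
move=> d0 n0 size_w.
have partial m : (m < n)%N ->
    \sum_(j < m.+1) (-1) ^+ j * (cut_alternating d (d * j) w)%:R =
    (-1) ^+ m * (alternating_from d (d * m.+1) w)%:R :> rat.
  elim: m => [|m IHm] ltmn; rewrite big_ord_recr /=.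
    by rewrite big_ord0 add0r (cut_alternating_split d0 size_w).
  rewrite IHm 1?ltnW // (cut_alternating_split d0 size_w) //= natrD mulrDr addrA.
  by rewrite exprS mulN1r !mulNr subrr add0r.
case: n n0 size_w partial => // m _ size_w partial.
rewrite big_ord_recr /= partial // exprS mulN1r mulNr.
suff -> : cut_alternating d (d * m.+1) w = alternating_from d (d * m.+1) w.
  by rewrite subrr.
have lekw : (d * m.+1 <= size w)%N by rewrite size_w.
apply/(cut_alternatingP (dvdn_mulr m.+1 (dvdnn d)) lekw)/descents_areP => dw i lti.
  by apply: dw; rewrite // neq_ltn -size_w; case/andP: lti => _ ->.
by move=> _; apply: dw.
Qed.

(** * Counting words on a set *)

Definition count_words (N : nat) (S : {set 'I_N}) (P : pred (seq nat)) : nat :=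
  count (fun w : seq 'I_N => P (map val w)) (permutations (enum S)).

Lemma sorted_enum_ord (N : nat) (B : {set 'I_N}) : sorted leq (map val (enum B)).
Proof.
rewrite sorted_map /enum_mem -enumT.
apply: sorted_filter => [j i k /=|]; first exact: leq_trans.
by rewrite -sorted_map val_enum_ord iota_sorted.
Qed.

(** B is the set of the letters before the cut; since these letters increase,
    B determines them, and only the word after the cut remains to be chosen. *)
Lemma count_words_cut (d k N : nat) (S : {set 'I_N}) : (k <= #|S|)%N ->
  count_words S (cut_alternating d k) =
  (\sum_(B : {set 'I_N} | (B \subset S) && (#|B| == k))
     count_words (S :\: B) (alternating d))%N.
Proof.
move=> lekS; rewrite /count_words -sum1_count big_seq_cond.
rewrite (partition_big (fun w : seq 'I_N => [set x in take k w])
   (fun B : {set 'I_N} => (B \subset S) && (#|B| == k))) /=.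
  apply: eq_bigr => B /andP[sBS /eqP cardB].
  rewrite sum1_count -!size_filter -[RHS](size_map (cat (enum B))).
  have size_B : size (enum B) = k by rewrite -cardE.
  apply/perm_size/uniq_perm.
  - by rewrite filter_uniq // permutations_uniq.
  - rewrite map_inj_uniq ?filter_uniq ?permutations_uniq // => u v.
    by move/(congr1 (drop k)); rewrite !drop_size_cat.
  move=> w; rewrite mem_filter mem_permutations.
  apply/idP/mapP=> [/andP[/andP[/andP[_ /andP[sw aw]] /eqP defB] pw] | [t]].
    have [uw mw] : uniq w /\ w =i S.
      by rewrite (perm_uniq pw) enum_uniq; split=> // x; rewrite (perm_mem pw) mem_enum.
    move: uw; rewrite -{1}(cat_take_drop k w) cat_uniq => /and3P[ut /hasPn td ud].
    have mB x : (x \in take k w) = (x \in B) by rewrite -defB inE.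
    exists (drop k w).
      rewrite mem_filter map_drop aw mem_permutations uniq_perm ?enum_uniq //.
      move=> x; rewrite mem_enum in_setD -mB -mw -{3}(cat_take_drop k w) mem_cat.
      have := td x; case: (x \in drop k w) => [->//|_]; first by rewrite orbT.
      by rewrite orbF andNb.
    rewrite -{1}(cat_take_drop k w); congr (_ ++ _).
    apply: (inj_map val_inj); apply: (sorted_eq leq_trans anti_leq).
    - by rewrite map_take.
    - exact: sorted_enum_ord.
    apply/perm_map/uniq_perm; rewrite ?enum_uniq // => x.
    by rewrite mem_enum mB.
  rewrite mem_filter mem_permutations => /andP[at_ pt] ->.
  have pS : perm_eq (enum B ++ t) (enum S).
    have ut : uniq t by rewrite (perm_uniq pt) enum_uniq.
    have mt x : (x \in t) = (x \notin B) && (x \in S).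
      by rewrite (perm_mem pt) mem_enum in_setD.
    apply: uniq_perm; rewrite ?enum_uniq //.
      rewrite cat_uniq enum_uniq ut andbT; apply/hasPn => x.
      by rewrite mt mem_enum => /andP[].
    move=> x; rewrite mem_cat !mem_enum mt.
    by case: (boolP (x \in B)) => //= /(subsetP sBS).
  rewrite pS /cut_alternating map_cat.
  rewrite take_size_cat ?drop_size_cat ?size_map // at_ sorted_enum_ord !andbT /=.
  by apply/eqP/setP => x; rewrite take_size_cat // inE mem_enum.
move=> w; rewrite mem_permutations => /andP[pw _].
have uw : uniq w by rewrite (perm_uniq pw) enum_uniq.
have size_w : size w = #|S| by rewrite (perm_size pw) -cardE.
apply/andP; split.
  apply/subsetP=> x; rewrite inE => /mem_take.
  by rewrite (perm_mem pw) mem_enum.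
rewrite cardsE; have /card_uniqP-> := take_uniq k uw.
by rewrite size_take_min size_w (minn_idPl lekS).
Qed.

(** The cut at 0 is good exactly for the d-alternating words on S, while the
    induction hypothesis evaluates the numbers of words with a good cut at d j
    for j > 0.  The relation of signed_cuts_eq0 therefore expresses the first
    number through the others, and this is the recurrence of the E_(di). *)
Lemma alternating_words (d n N : nat) (S : {set 'I_N}) :
  (0 < d)%N -> #|S| = (d * n)%N ->
  gen_euler d (d * n) = (-1) ^+ n * (count_words S (alternating d))%:R.
Proof.
move=> d0; elim/ltn_ind: n S => n IHn S cardS.
have [n0 | n0] := posnP n.
  rewrite n0 muln0 gen_euler0 mul1r /count_words.
  move/eqP: cardS; rewrite n0 muln0 cards_eq0 => /eqP->.
  by rewrite enum_set0.
have cut_count j : (0 < j <= n)%N ->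
    (-1) ^+ j * (count_words S (cut_alternating d (d * j)))%:R =
    (-1) ^+ n * ('C(d * n, d * (n - j))%:R * gen_euler d (d * (n - j))).
  case/andP=> j0 lejn.
  have lej : (d * j <= #|S|)%N by rewrite cardS leq_pmul2l.
  rewrite count_words_cut // natr_sum.
  rewrite (eq_bigr (fun=> (-1) ^+ (n - j) * gen_euler d (d * (n - j)))); last first.
    move=> B /andP[sBS /eqP cardB].
    rewrite (IHn (n - j)%N _ (S :\: B)) ?mulrA -?exprMn ?mulrNN ?mulr1 ?expr1n ?mul1r //.
    - by rewrite ltn_subrL n0 j0.
    - by rewrite cardsDS // cardS cardB mulnBr.
  rewrite sumr_const.
  have -> : #|[pred B : {set 'I_N} | (B \subset S) && (#|B| == d * j)%N]| =
      'C(d * n, d * (n - j)).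
    rewrite mulnBr bin_sub ?leq_pmul2l // -cardS -cards_draws.
    by apply: eq_card => B; rewrite inE.
  by rewrite mulr_natl !mulrnAr mulrA -exprD subnKC.
have count_sum P : (count_words S P)%:R =
    \sum_(w <- permutations (enum S)) (P (map val w))%:R :> rat.
  rewrite /count_words -sum1_count big_mkcond natr_sum.
  by apply: eq_bigr => w _; case: (P _).
have: \sum_(j < n.+1) (-1) ^+ j * (count_words S (cut_alternating d (d * j)))%:R
    = 0 :> rat.
  under eq_bigr => j _ do rewrite count_sum mulr_sumr.
  rewrite exchange_big big1_seq //= => w; rewrite mem_permutations => pw.
  by apply: signed_cuts_eq0; rewrite // size_map (perm_size pw) -cardE.
have -> : count_words S (alternating d) = count_words S (cut_alternating d 0).
  by apply: eq_count => w; rewrite /cut_alternating take0 drop0.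
rewrite big_ord_recl /= muln0 mul1r.
under eq_bigr => j _ do rewrite /bump add1n cut_count ?ltn_ord //.
rewrite -mulr_sumr => /eqP; rewrite addr_eq0 => /eqP ->.
rewrite mulrN mulrA -exprMn mulrNN mulr1 expr1n mul1r gen_euler_rec_multiples //.
by congr (- _); rewrite big_mkord (reindex_inj rev_ord_inj).
Qed.

(** * One-line notation *)

Lemma nth_word_perm (n : nat) (s : 'S_n) (i : 'I_n) :
  nth 0%N (map val (codom s)) i = s i.
Proof.
rewrite (nth_map i) ?size_codom ?card_ord //.
by rewrite codomE (nth_map i) ?size_enum_ord // nth_ord_enum.
Qed.

Lemma mem_descents (n : nat) (s : 'S_n) (i : 'I_n) :
  (i \in descents s) = (0 < i)%N && descent_at (map val (codom s)) i.
Proof.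
rewrite inE /descent_at nth_word_perm.
apply/existsP/andP=> [[j /andP[/eqP def_i lt_s]] | [i0 lt_s]].
  by rewrite -def_i nth_word_perm.
have lti : (i.-1 < n)%N by rewrite (leq_ltn_trans (leq_pred i)).
exists (Ordinal lti); rewrite /= prednK // eqxx /=.
by move: lt_s; rewrite -[i.-1]/(val (Ordinal lti)) nth_word_perm.
Qed.

Lemma mem_d_alternating (d n : nat) (s : 'S_n) :
  (s \in d_alternating d n) = alternating d (map val (codom s)).
Proof.
rewrite inE; apply/eqP/descents_areP=> [des_s i | des_w].
  rewrite size_map size_codom card_ord => /andP[i0 lti].
  have := mem_descents s (Ordinal lti).
  by rewrite des_s inE /= i0.
apply/setP=> i; rewrite mem_descents inE; case: (posnP i) => //= i0.
by rewrite des_w // i0 size_map size_codom card_ord ltn_ord.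
Qed.

(** Permutations of 'I_n correspond to the words on 'I_n: one-line notation is
    injective, and there are n! of both. *)
Lemma d_alternating_words (d n : nat) :
  #|d_alternating d n| = count_words [set: 'I_n] (alternating d).
Proof.
have inj_codom : injective (fun s : 'S_n => codom s).
  move=> s t; rewrite !codomE => /eq_in_map st.
  by apply/permP => i; rewrite st ?mem_enum.
pose L := [seq codom (s : 'I_n -> 'I_n) | s : 'S_n <- enum [set: 'S_n]].
have sub_L : {subset L <= permutations (enum [set: 'I_n])}.
  move=> w /mapP[s _ ->]; rewrite mem_permutations.
  apply: uniq_perm => [||i]; rewrite ?enum_uniq //.
    by rewrite codomE map_inj_uniq ?enum_uniq //; apply: perm_inj.
  by rewrite mem_enum inE -[i](permKV s) codom_f.
have uL : uniq L by rewrite map_inj_uniq // enum_uniq.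
have [_ eq_L] : (size L = size (permutations (enum [set: 'I_n]))) *
    (L =i permutations (enum [set: 'I_n])).
  apply: uniq_min_size => //.
  by rewrite size_permutations ?enum_uniq // size_map -!cardE !cardsT card_Sn card_ord.
have /seq.permP := uniq_perm uL (permutations_uniq _) eq_L.
rewrite /count_words => <-; rewrite count_map enum_setT -size_filter.
rewrite cardE {1}/enum_mem; congr (size _).
by apply: eq_filter => s /=; apply: mem_d_alternating.
Qed.

(** * The theorem *)

Theorem theorem3p1 (d : nat) (hd : (2 <= d)%N) :
  [/\ (forall n : nat,
         gen_euler d n =
         \sum_(p : n.-bseq {set 'I_n} | d_partition d [set: 'I_n] p)
            (-1) ^+ size p),
      (forall n : nat, gen_euler d n \is a Num.int),
      (forall n : nat, ~~ (d %| n)%N -> gen_euler d n = 0),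
      gen_euler d 0 = 1 /\
      (forall n : nat, (1 <= n)%N ->
         gen_euler d (d * n) =
         - \sum_(0 <= i < n) 'C(d * n, d * i)%:R * gen_euler d (d * i))
    & (forall n : nat,
         gen_euler d (d * n) = (-1) ^+ n * #|d_alternating d (d * n)|%:R)].
Proof.
have d0 : (0 < d)%N by apply: ltnW.
split.
- by move=> n; rewrite signed_d_partitions ?cardsT ?card_ord.
- exact: gen_euler_int.
- exact: gen_euler_eq0.
- split; first exact: gen_euler0.
  by move=> n; apply: gen_euler_rec_multiples.
move=> n; rewrite d_alternating_words; apply: alternating_words => //.
by rewrite cardsT card_ord.
Qed.
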